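(* Let $n$ and $k$ be positive integers, and let $c\colon E(K_{2nk})\to [k]$ be a colour-balanced edge-colouring of the complete graph $K_{2nk}$ on $2nk$ vertices, where $[k]=\{1,2,\dots,k\}$. Then there is a perfect matching $M$ of $K_{2nk}$ satisfying $$f(M)\le 4^{k^2},\qquad\text{where}\qquad f(M)=\sum_{i=1}^k\Bigl|\,|c^{-1}(i)\cap M|-n\,\Bigr|.$$
   Context: An edge-colouring $c\colon E(G)\to[k]$ of a graph $G$ is called colour-balanced if each colour $i\in[k]$ is used on exactly the same number of edges, i.e. $|c^{-1}(i)|=|E(G)|/k$ for all $i$. For a perfect matching $M$, $|c^{-1}(i)\cap M|$ is the number of edges of $M$ having colour $i$. *)

(* Defs.v *)
From HB Require Import structures.
From mathcomp Require Import all_boot all_order all_algebra.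

Set Implicit Arguments.
Unset Strict Implicit.
Unset Printing Implicit Defensive.

Import Order.TTheory GRing.Theory Num.Theory.

(* Edges of the complete graph on V are its two-element vertex sets; the colour
   set [k] = {1, ..., k} is represented by 'I_k. *)
Definition edge (V : finType) : finType := {e : {set V} | #|e| == 2}.

Section Colourings.
Variables (V : finType) (k : nat).
Implicit Types (c : edge V -> 'I_k) (M : {set edge V}).

Definition colour_class c (i : 'I_k) : {set edge V} := [set e | c e == i].

(* |c^-1(i)| = |E| / k, with the exact division cleared. *)
Definition colour_balanced c : Prop :=
  forall i : 'I_k, #|colour_class c i| * k = #|edge V|.

Definition perfect_matching M : Prop :=
  (forall e1 e2, e1 \in M -> e2 \in M -> e1 != e2 -> [disjoint val e1 & val e2])
  /\ (forall v : V, exists2 e, e \in M & v \in val e).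

(* `|_ - _|%N is the absolute value of a difference taken in int, so the
   subtraction is not truncated. *)
Definition imbalance (n : nat) c M : nat :=
  \sum_(i < k) `|#|colour_class c i :&: M| - n|.

End Colourings.

(* Main.v *)
(* Replacing two edges xx', yy' of a perfect matching by xy, x'y' is a switch;
   its type is the tuple of the four colours involved, and the type determines
   the effect on the colour counts. As every colour class has the same size, the
   effects of all the switches of a matching sum to a negative multiple of its
   vector of excesses v. If P_t is the number of switches of type t, N the number
   of vertices and T = k^4 the number of types, one can perform floor(P_t / (8NT))
   switches of every type t simultaneously on disjoint sets of vertices; this
   shrinks v by a factor 1 - O(1/T), up to a rounding error O(T) in l^1 norm that
   does not depend on n. So v can be made smaller as long as its norm exceeds
   a multiple of T^2 = k^8, which for k >= 3 is at most 4^(k^2). For k <= 2 all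
   excesses have the same absolute value and a single switch suffices. *)
Require Import Defs.
From HB Require Import structures.
From mathcomp Require Import all_boot all_order all_algebra.
From mathcomp Require Import zify ring.

Set Implicit Arguments.
Unset Strict Implicit.
Unset Printing Implicit Defensive.

Import Order.TTheory GRing.Theory Num.Theory.

(** * Arithmetic preliminaries *)

Lemma Posz_sum (I : Type) (r : seq I) (P : pred I) (F : I -> nat) :
  Posz (\sum_(j <- r | P j) F j) = (\sum_(j <- r | P j) Posz (F j))%R.
Proof. exact: (big_morph Posz (id1 := 0%R) (op1 := +%R)). Qed.

(** For [q = k] this says 4T <= 2^(k^2), whose square is 16T^2 <= 4^(k^2). The base case is 324 <=
    512; each step multiplies the right side by at least 16, and (q+1)^4 <= (2q)^4 = 16q^4. *)
Lemma power_bound q : 3 <= q -> 4 * (q * q * q * q) <= 2 ^ (q * q).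
Proof.
elim: q => // q IH; rewrite ltnS leq_eqVlt => /orP[/eqP<- //|q3].
have -> : 2 ^ (q.+1 * q.+1) = 2 ^ (q * q) * 2 ^ (q + q).+1.
  by rewrite -expnD; congr (_ ^ _); ring.
have h16 : 16 <= 2 ^ (q + q).+1 by rewrite (_ : 16 = 2 ^ 4) // leq_exp2l //; lia.
apply: leq_trans (leq_mul (IH q3) h16).
have q2 : q.+1 <= q + q by lia.
apply: (@leq_trans (4 * ((q + q) * (q + q) * (q + q) * (q + q)))); last by lia.
by rewrite leq_pmul2l //; exact: leq_mul (leq_mul (leq_mul q2 q2) q2) q2.
Qed.

(** * Single switches and their effect on the colour counts *)

Section Switching.
Variables (V : finType) (k n : nat) (col : V -> V -> 'I_k).
Hypothesis colC : forall x y, col x y = col y x.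

Definition colour_type : finType := ('I_k * 'I_k * 'I_k * 'I_k)%type.

(** A perfect matching is encoded by the map sending each vertex to its partner. *)
Definition matching_map (s : V -> V) := involutive s /\ forall x, s x != x.

Definition admissible (s : V -> V) (p : V * V) := (p.2 != p.1) && (p.2 != s p.1).

Definition switch_type (s : V -> V) (p : V * V) : colour_type :=
  (col p.1 (s p.1), col p.2 (s p.2), col p.1 p.2, col (s p.1) (s p.2)).

Definition effect (t : colour_type) (i : 'I_k) : int :=
  let: (a, b, a', b') := t in
  (Posz (a' == i) + Posz (b' == i) - Posz (a == i) - Posz (b == i))%R.

(* Every edge of the matching is seen from both of its ends, so this is twice
   the excess of colour i. *)
Definition excess (s : V -> V) (i : 'I_k) : int :=
  (\sum_x Posz (col x (s x) == i) - Posz (2 * n))%R.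

Definition discrepancy (s : V -> V) : int := (\sum_i `|excess s i|)%R.

Definition switch (s : V -> V) (x y z : V) : V :=
  if z == x then y else if z == y then x else
  if z == s x then s y else if z == s y then s x else s z.

Lemma admissible_neq s x y : matching_map s -> admissible s (x, y) ->
  [/\ y != x, s x != x, s x != y & [/\ s y != x, s y != y & s y != s x]].
Proof.
move=> [sK sN] /andP[/= yx ysx]; split=> //; last split=> //.
- by rewrite eq_sym.
- by apply: contraNneq ysx => <-; rewrite sK.
- by rewrite (inj_eq (can_inj sK)).
Qed.

Lemma switch_matching s x y : matching_map s -> admissible s (x, y) ->
  matching_map (switch s x y).
Proof.
move=> ms /(admissible_neq ms)[/negPf h1 /negPf h2 /negPf h3 [/negPf h4 /negPf h5 /negPf h6]].
case: ms => sK sN; split=> z; rewrite /switch.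
- case: (eqVneq z x) => [->|zx]; first by rewrite h1 eqxx.
  case: (eqVneq z y) => [->|zy]; first by rewrite eqxx.
  case: (eqVneq z (s x)) => [->|zsx]; first by rewrite h4 h5 h6 eqxx.
  case: (eqVneq z (s y)) => [->|zsy]; first by rewrite h2 h3 eqxx.
  rewrite !(inj_eq (can_inj sK)) (negPf zx) (negPf zy).
  by rewrite !(can2_eq sK sK) (negPf zsx) (negPf zsy) sK.
- case: (eqVneq z x) => [->|zx]; first by rewrite h1.
  case: (eqVneq z y) => [->|zy]; first by rewrite eq_sym h1.
  case: (eqVneq z (s x)) => [->|zsx]; first by rewrite h6.
  by case: (eqVneq z (s y)) => [->|zsy]; first by rewrite eq_sym h6.
Qed.

Lemma switch_outside s x y z : z \notin [set x; y; s x; s y] ->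
  switch s x y z = s z.
Proof.
rewrite !inE !negb_or /switch -!andbA => /and4P[/negPf-> /negPf-> /negPf-> /negPf->].
by [].
Qed.

(** Only [x], [y], [s x], [s y] change partner, and each edge lost or gained is counted from both
    ends, whence the factor 2. *)
Lemma excess_switch s x y i : matching_map s -> admissible s (x, y) ->
  (excess (switch s x y) i = excess s i + effect (switch_type s (x, y)) i *+ 2)%R.
Proof.
move=> ms /(admissible_neq ms)[h1 h2 h3 [h4 h5 h6]]; case: ms => sK sN.
rewrite /excess; have split4 (f : V -> int) : (\sum_z f z = f x + (f y + (f (s x) +
    (f (s y) + \sum_(z | z \notin [set x; y; s x; s y]) f z))))%R.
  rewrite (bigD1 x) // (bigD1 y) //= (bigD1 (s x)) /= ?h2 ?h3 //.
  rewrite (bigD1 (s y)) /= ?h4 ?h5 ?h6 //; do 4 congr (_ + _)%R.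
  by apply: eq_bigl => z; rewrite !inE !negb_or -!andbA.
rewrite !split4.
under eq_bigr => z hz do rewrite switch_outside //.
rewrite /switch !eqxx (negPf h1) (negPf h2) (negPf h3) (negPf h4) (negPf h5) (negPf h6).
rewrite /effect /= !sK (colC (s y) (s x)) (colC y x) (colC (s x) x) (colC (s y) y).
rewrite mulr2n; ring.
Qed.

Lemma effect_bound t i : (`|effect t i| <= 2)%R.
Proof. by case: t => [[[a b] a'] b']; rewrite /effect; lia. Qed.

Lemma effect_sum_bound t : (\sum_i `|effect t i| <= 4)%R.
Proof.
case: t => [[[a b] a'] b'].
have one (j : 'I_k) : (\sum_i Posz (j == i) = 1)%R.
  rewrite (bigD1 j) //= eqxx big1 // => i /negPf.
  by rewrite eq_sym => ->.
apply: (@le_trans _ _ (\sum_i (Posz (a' == i) + Posz (b' == i) + Posz (a == i) + Posz (b == i)))%R).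
  by apply: ler_sum => i _; rewrite /effect; lia.
by rewrite !big_split /= !one.
Qed.

(** * Averaging over all switches *)

Hypothesis card_col : forall i : 'I_k,
  \sum_x \sum_(y | y != x) (col x y == i : nat) = 2 * n * (#|V| - 1).

(** Write N for [#|V|]. The pair xy runs over all ordered pairs off the diagonal and off the
    matching, so it has colour i in 2n(N-1) - C cases; applying [s] to both entries gives the same
    count for x'y'. Each removed edge contributes C(N-2). The total is 2(N-1)(2n - C). *)
Lemma sum_effect s i : matching_map s ->
  (\sum_(p | admissible s p) effect (switch_type s p) i
     = - excess s i * Posz (2 * (#|V| - 1)))%R.
Proof.
move=> ms; case: (ms) => sK sN.
set C := (\sum_x Posz (col x (s x) == i))%R.
have pairE (f : V * V -> int) : (\sum_(p | admissible s p) f p =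
    \sum_x \sum_(y | (y != x) && (y != s x)) f (x, y))%R.
  by rewrite pair_big_dep /=; apply: eq_big => [] [].
have sumxy : (\sum_(p | admissible s p) Posz (col p.1 p.2 == i) =
    Posz (2 * n * (#|V| - 1)) - C)%R.
  apply/eqP; rewrite eq_sym subr_eq pairE /C -big_split -(card_col i) /=.
  rewrite Posz_sum.
  apply/eqP; apply: eq_bigr => x _; rewrite addrC.
  rewrite Posz_sum.
  by rewrite (bigD1 (s x)) //=.
have adms p : admissible s (s p.1, s p.2) = admissible s p.
  by rewrite /admissible /= !(inj_eq (can_inj sK)).
have sumss : (\sum_(p | admissible s p) Posz (col (s p.1) (s p.2) == i) =
    Posz (2 * n * (#|V| - 1)) - C)%R.
  rewrite -sumxy [RHS](reindex_inj (h := fun p => (s p.1, s p.2))) /=.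
    by apply: eq_bigl => p; rewrite adms.
  by move=> [x y] [x' y'] [] /(can_inj sK)-> /(can_inj sK)->.
have sum1 : (\sum_(p | admissible s p) Posz (col p.1 (s p.1) == i) =
    C * Posz (#|V| - 2))%R.
  rewrite pairE /C mulr_suml; apply: eq_bigr => x _ /=.
  rewrite sumr_const -mulr_natr; congr (_ * _)%R.
  rewrite natz; congr Posz.
  rewrite -(cardC (pred2 x (s x))) card2 eq_sym sN /=.
  by rewrite addKn; apply: eq_card => y; rewrite !inE negb_or.
have admC p : admissible s (p.2, p.1) = admissible s p.
  rewrite /admissible /= eq_sym; congr (_ && _).
  by rewrite -(can2_eq sK sK) eq_sym.
have sum2 : (\sum_(p | admissible s p) Posz (col p.2 (s p.2) == i) =
    C * Posz (#|V| - 2))%R.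
  rewrite -sum1 [RHS](reindex_inj (h := fun p => (p.2, p.1))) /=.
    by apply: eq_bigl => p; rewrite admC.
  by move=> [x y] [x' y'] [] -> ->.
rewrite /effect /switch_type /= !sumrB big_split /= sumxy sumss sum1 sum2.
rewrite /excess -/C.
(* Truncation in [#|V| - 2] is harmless: with fewer than two vertices, [s] having no fixed point
   leaves no vertex at all. *)
have [V2|V2] := leqP 2 #|V|; first by rewrite -(subnK V2); nia.
have -> : C = 0%R.
  rewrite /C big1 // => x _; move: V2.
  rewrite ltnNge; case/negP.
  by rewrite (cardD1 x) (cardD1 (s x)) !inE sN.
have -> : #|V| - 1 = 0 by lia.
by rewrite !muln0 mulr0 mul0r.
Qed.

Definition type_count (s : V -> V) (t : colour_type) : nat :=
  #|[pred p | admissible s p && (switch_type s p == t)]|.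

Lemma sum_type_count s i : matching_map s ->
  (\sum_t Posz (type_count s t) * effect t i
     = - excess s i * Posz (2 * (#|V| - 1)))%R.
Proof.
move=> ms; rewrite -sum_effect // (partition_big (switch_type s) predT) //.
apply: eq_bigr => t _.
rewrite [RHS](eq_bigr (fun=> effect t i)) => [|p /andP[_ /eqP-> //]].
by rewrite sumr_const -mulr_natl natz.
Qed.

(** * Performing many switches on disjoint sets of vertices *)

(* s' comes from switches of s with total effect d, all performed inside U; the
   switches of s avoiding U are still available, with the same type, in s'. *)
Definition switched (s s' : V -> V) (U : {set V}) (d : 'I_k -> int) : Prop :=
  [/\ matching_map s', forall z, z \in U -> s z \in U,
      forall z, z \notin U -> s' z = s z
    & forall i, (excess s' i = excess s i + d i *+ 2)%R].

(** At most [2 * #|V| * #|U|] ordered pairs meet [U], so some pair of type [t] avoids it; there [s']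
    agrees with [s]. *)
Lemma switched_step s s' U d t : matching_map s -> switched s s' U d ->
  2 * #|V| * #|U| < type_count s t ->
  exists s1 U1, switched s s1 U1 (fun i => d i + effect t i)%R /\ #|U1| <= #|U| + 4.
Proof.
move=> ms [ms' Us s's ex] lt.
have [[x y] /andP[/andP[adm /eqP tt] /andP[/= xU yU]]] : exists p : V * V,
    (admissible s p && (switch_type s p == t)) && ((p.1 \notin U) && (p.2 \notin U)).
  apply/existsP; apply: contraTT lt; rewrite negb_exists => /forallP h.
  rewrite -leqNgt; apply: (@leq_trans #|setX U setT :|: setX setT U|).
    apply: subset_leq_card; apply/subsetP => p; rewrite inE => hp.
    by have := h p; rewrite hp /= negb_and !negbK !inE andbT.
  apply: leq_trans (leq_card_setU _ _) _.
  by rewrite !cardsX cardsT; nia.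
have [sK _] := ms.
have adm' : admissible s' (x, y) by rewrite /admissible /= (s's x).
exists (switch s' x y), (U :|: [set x; y; s x; s y]); split; last first.
  apply: leq_trans (leq_card_setU _ _) _; rewrite leq_add2l.
  have := (leq_card_setU [set x; y; s x] [set s y]).1.
  have := (leq_card_setU [set x; y] [set s x]).1.
  have := (leq_card_setU [set x] [set y]).1.
  by rewrite !cards1; lia.
split=> [|z|z|i].
- exact: switch_matching.
- rewrite !inE => /orP[/Us-> //|].
  by rewrite -!orbA => /or4P[] /eqP->; rewrite ?sK eqxx ?orbT.
- rewrite inE negb_or => /andP[zU zn].
  by rewrite switch_outside ?s's.
- rewrite excess_switch // ex.
  have -> : switch_type s' (x, y) = t.
    by rewrite -tt /switch_type /= !s's.
  by rewrite /= mulrnDl [RHS]addrA.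
Qed.

(** Each switch blocks four more vertices, so at most [#|U| + 4 * b.-1] are blocked when the last
    one is chosen. *)
Lemma switched_repeat s s' U d t b : matching_map s -> switched s s' U d ->
  2 * #|V| * (#|U| + 4 * b.-1) < type_count s t ->
  exists s1 U1, switched s s1 U1 (fun i => d i + Posz b * effect t i)%R
    /\ #|U1| <= #|U| + 4 * b.
Proof.
move=> ms sw; elim: b => [_|b IH lt].
  exists s', U; rewrite muln0 addn0; split=> //; case: sw => h1 h2 h3 h4.
  by split=> // i; rewrite h4 mul0r addr0.
have [|s1 [U1 [sw1 c1]]] := IH; first by apply: leq_ltn_trans lt; nia.
have [|s2 [U2 [[h1 h2 h3 h4] c2]]] := switched_step (t := t) ms sw1.
  by apply: leq_ltn_trans lt; rewrite /=; nia.
exists s2, U2; split; last by lia.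
split=> // i; rewrite h4; congr (_ + _ *+ 2)%R.
by rewrite -addn1 PoszD; ring.
Qed.

(* The switches of a type are chosen after those of all rarer types: then the
   vertices used so far cannot block all the switches of this type. *)
Lemma switched_many s (b : colour_type -> nat) (S : {set colour_type}) :
  0 < #|V| -> matching_map s ->
  (forall t, b t * (8 * #|V| * #|colour_type|) <= type_count s t) ->
  exists s' U, switched s s' U (fun i => \sum_(t in S) Posz (b t) * effect t i)%R
    /\ #|U| <= 4 * \sum_(t in S) b t.
Proof.
move=> V0 ms hb; move: {2}#|S| (leqnn #|S|) => m.
elim: m S => [|m IH] S cS.
  exists s, set0; move: cS; rewrite leqn0 cards_eq0 => /eqP->.
  rewrite cards0; split=> //; split=> // [z|i]; first by rewrite inE.
  by rewrite big_set0 mul0rn addr0.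
have [->|[t0 t0S]] := set_0Vmem S; first by apply: IH; rewrite cards0.
(* Splitting off the most frequent type makes the induction treat it last. *)
pose t := [arg max_(t > t0 in S) type_count s t].
have [tS tmax] : t \in S /\ forall u, u \in S -> type_count s u <= type_count s t.
  by rewrite /t; case: arg_maxnP.
have cD : #|S :\ t| = #|S|.-1 by rewrite (cardsD1 t S) tS.
have [|s1 [U1 [sw1 c1]]] := IH (S :\ t); first by lia.
have [b0|bpos] := posnP (b t).
  exists s1, U1; split; last first.
    by rewrite (big_setD1 t) //= b0.
  case: sw1 => h1 h2 h3 h4; split=> // i.
  by rewrite (big_setD1 t) //= b0 mul0r add0r.
have le1 : (\sum_(u in S :\ t) b u) * (8 * #|V| * #|colour_type|)
    <= #|S :\ t| * type_count s t.
  rewrite big_distrl /= -sum_nat_const; apply: leq_sum => u.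
  by rewrite !inE => /andP[_ /tmax]; apply: leq_trans.
have leS : #|S| <= #|colour_type| by exact: max_card.
have S0 : 0 < #|S| by apply/card_gt0P; exists t.
have [|s2 [U2 [[h1 h2 h3 h4] c2]]] := switched_repeat (b := b t) (t := t) ms sw1.
  have T0 : 0 < #|colour_type| by lia.
  (* With Q = 8NT, P the count of [t] and B the sum of [b] over the rarer types: BQ <= (|S|-1)P and
     (b-1)Q < P, so (B+b-1)Q < |S|P <= TP. *)
  rewrite -(ltn_pmul2r T0); move: c1 le1 (hb t); rewrite cD.
  move: (\sum_(u in S :\ t) b u) (type_count s t) => B P c1 le1 hbt.
  have q0 : 0 < 8 * #|V| * #|colour_type| by rewrite !muln_gt0 V0.
  apply: (@leq_ltn_trans ((B + (b t).-1) * (8 * #|V| * #|colour_type|))).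
    rewrite (_ : _ * #|colour_type| =
      (#|U1| + 4 * (b t).-1) * (2 * #|V| * #|colour_type|)); last by ring.
    rewrite (_ : (B + _) * _ = (4 * B + 4 * (b t).-1) * (2 * #|V| * #|colour_type|)); last by ring.
    by rewrite leq_mul2r; apply/orP; right; lia.
  apply: (@leq_trans (#|S| * P)); last by rewrite mulnC leq_mul2l leS orbT.
  rewrite mulnDl -(prednK S0) mulSn addnC -addSn leq_add //.
  by apply: leq_trans hbt; rewrite -{2}(prednK bpos) mulSn; lia.
exists s2, U2; split; last by rewrite (big_setD1 t) //= mulnDr addnC (leq_trans c2) // leq_add2r.
split=> // i; rewrite h4 [in RHS](big_setD1 t) //=.
by congr (_ + _ *+ 2)%R; rewrite addrC.
Qed.


(** * Decreasing the discrepancy *)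

(** Rounding down P_t/Q leaves remainders below Q. With F, F' the old and new discrepancies, QF' <=
    (Q - 4(N-1))F + 8TQ, and 8TQ = 64NT^2 is less than 4(N-1)F by hypothesis. *)
Lemma balancing_step s : 0 < #|V| -> matching_map s ->
  (Posz (16 * #|V| * #|colour_type| ^ 2) < discrepancy s * Posz (#|V| - 1))%R ->
  exists s', matching_map s' /\ (discrepancy s' < discrepancy s)%R.
Proof.
move=> V0 ms big; set T := #|colour_type| in big; set Q := 8 * #|V| * T.
have [|s' [U [[ms' _ _ ex] _]]] := switched_many (s := s)
    (b := fun t => type_count s t %/ Q) setT V0 ms.
  by move=> t; exact: leq_divM.
exists s'; split=> //.
have T0 : 0 < T by case/card_gt0P: V0 => x _; apply/card_gt0P; exists (switch_type s (x, x)).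
have Q0 : (0 < Posz Q)%R by rewrite ltz_nat !muln_gt0 V0.
pose r t : nat := type_count s t %% Q.
have exQ i : (Posz Q * excess s' i = (Posz Q - Posz (4 * (#|V| - 1))) * excess s i
    - (\sum_t Posz (r t) * effect t i) *+ 2)%R.
  have : (Posz Q * (\sum_(t in [set: colour_type]) Posz (type_count s t %/ Q) * effect t i)
      = (- excess s i * Posz (2 * (#|V| - 1))) - \sum_t Posz (r t) * effect t i)%R.
    rewrite -sum_type_count // -sumrB mulr_sumr; apply: eq_big => [t|t _].
      by rewrite inE.
    by rewrite {2}(divn_eq (type_count s t) Q) /r PoszD PoszM; ring.
  rewrite ex mulrDr mulrnAr => e; rewrite e; ring.
(* The coefficient of the old excess must be nonnegative to come out of the absolute value. *)
have Qge : (0 <= Posz Q - Posz (4 * (#|V| - 1)))%R by rewrite /Q; nia.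
have absQ i : (Posz Q * `|excess s' i| <= (Posz Q - Posz (4 * (#|V| - 1))) * `|excess s i|
    + (\sum_t Posz Q * `|effect t i|) *+ 2)%R.
  rewrite -[X in (X * _)%R]gtr0_norm // -normrM exQ.
  apply: le_trans (ler_normB _ _) _; rewrite normrM ger0_norm // lerD2l.
  rewrite normrMn lerMn2r /=; apply: le_trans (ler_norm_sum _ _ _) _.
  apply: ler_sum => t _; rewrite normrM ler_wpM2r //= lez_nat ltnW // ltn_mod.
  by rewrite -ltz_nat.
rewrite -(ltr_pM2l Q0) /discrepancy mulr_sumr.
apply: le_lt_trans (ler_sum _ (fun i _ => absQ i)) _.
rewrite big_split /= -mulr_sumr -/(discrepancy s) sumrMnl exchange_big /=.
have : (\sum_t \sum_i Posz Q * `|effect t i| <= Posz (T * (Q * 4)))%R.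
  apply: (@le_trans _ _ (\sum_(t : colour_type) Posz (Q * 4))%R).
    by apply: ler_sum => t _; rewrite -mulr_sumr PoszM ler_wpM2l ?effect_sum_bound.
  by rewrite sumr_const -mulr_natl natz PoszM.
move: big; rewrite /Q; move: (discrepancy s) => F; move: (\sum_t _)%R => E.
rewrite -mulnn !PoszM -/T mulr2n; move: (Posz #|V|) (Posz T) (Posz (#|V| - 1)) => N t N1.
nia.
Qed.

(** The effects on colour [i] sum to a negative multiple of its excess, so some switch moves it
    towards 0, by 2 or 4; an excess above 2 in absolute value cannot overshoot to an equally large
    one. *)
Lemma small_step s i : matching_map s -> (2 < `|excess s i|)%R -> 1 < #|V| ->
  exists s', matching_map s' /\ (`|excess s' i| < `|excess s i|)%R.
Proof.
move=> ms big V1.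
have [p adm neg] : exists2 p, admissible s p &
    (effect (switch_type s p) i * excess s i < 0)%R.
  apply/exists_inP; apply: contraT; rewrite negb_exists => /forallP h.
  have : (0 <= (\sum_(p | admissible s p) effect (switch_type s p) i) * excess s i)%R.
    by rewrite mulr_suml sumr_ge0 // => p adm; have := h p; rewrite adm -leNgt.
  rewrite sum_effect //; move: big; move: (excess s i) => w; nia.
case: p => x y in adm neg.
exists (switch s x y); split; first exact: switch_matching.
rewrite excess_switch //; have := effect_bound (switch_type s (x, y)) i.
move: neg big; move: (effect _ _) (excess _ _) => d w; nia.
Qed.

(** * Descent to a matching of low discrepancy *)

Hypotheses (n0 : 0 < n) (k0 : 0 < k) (cardV : #|V| = 2 * n * k).

Lemma sum_excess s : (\sum_i excess s i = 0)%R.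
Proof.
rewrite sumrB exchange_big /= sumr_const card_ord.
under eq_bigr => x _.
  rewrite (bigD1 (col x (s x))) //= eqxx big1 ?addr0; last first.
    by move=> i /negPf; rewrite eq_sym => ->.
  over.
rewrite sumr_const cardV. by rewrite -[Posz true]/(1%R : int) natz -mulr_natr natz -PoszM subrr.
Qed.

(** The excesses sum to 0, so those of two colours are opposite. *)
Lemma discrepancy_few_colours s i : k <= 2 ->
  discrepancy s = (Posz k * `|excess s i|)%R.
Proof.
move=> k2; have same j : (`|excess s j| = `|excess s i|)%R.
  have [->//|ji] := eqVneq j i.
  have := sum_excess s; rewrite (bigD1 i) //= (bigD1 j) //= big_pred0 => [|l].
    by rewrite addr0 addrC => /eqP; rewrite addr_eq0 => /eqP->; rewrite normrN.
  apply/negP => /andP[]; move: ji; rewrite -!val_eqE /=.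
  by move: (ltn_ord i) (ltn_ord j) (ltn_ord l); lia.
rewrite /discrepancy (eq_bigr _ (fun j _ => same j)).
by rewrite sumr_const card_ord -mulr_natl natz.
Qed.

Lemma discrepancy_descent s : matching_map s ->
  (Posz (2 * 4 ^ (k ^ 2)) < discrepancy s)%R ->
  exists s', matching_map s' /\ (discrepancy s' < discrepancy s)%R.
Proof.
move=> ms big; have V1 : 1 < #|V| by rewrite cardV; nia.
have [k3|k2] := leqP 3 k.
  apply: balancing_step => //; first exact: ltnW.
  have Tk : #|colour_type| = k * k * k * k by rewrite !card_prod card_ord.
  have := power_bound k3; rewrite -Tk -(leq_pmul2r (m := 4)) // => h.
  (* The discrepancy then exceeds 32T^2, and 2(N-1) >= N supplies the hypothesis of
     [balancing_step]. *)
  have : 16 * (#|colour_type| * #|colour_type|) <= 4 ^ (k ^ 2).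
    have -> : 4 ^ (k ^ 2) = 2 ^ (k * k) * 2 ^ (k * k).
      by rewrite -expnMn mulnn.
    by move: h; move: #|colour_type| (2 ^ _) => T a; nia.
  move: big V1; rewrite -mulnn; move: #|V| (4 ^ _) (discrepancy s) => N a F.
  move: #|colour_type| => T; nia.
pose i := Ordinal k0.
have [|s' [ms' lt]] := small_step (i := i) ms _ V1.
  (* The discrepancy exceeds 8 and is at most twice the absolute excess, which is therefore above
     4. *)
  have : 4 ^ 1 <= 4 ^ (k ^ 2) by rewrite leq_exp2l // expn_gt0 k0.
  move: big; rewrite (discrepancy_few_colours _ i) //.
  by move: (4 ^ (k ^ 2)) (excess s i) => a w; nia.
exists s'; split=> //; rewrite !(discrepancy_few_colours _ i) //.
by rewrite ltr_pM2l.
Qed.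

Lemma low_discrepancy s0 : matching_map s0 ->
  exists s, matching_map s /\ (discrepancy s <= Posz (2 * 4 ^ (k ^ 2)))%R.
Proof.
move=> ms0; have [m] : exists m : nat, (discrepancy s0 <= Posz m)%R.
  by exists `|discrepancy s0|%N; rewrite gez0_abs ?lexx // sumr_ge0.
elim: m s0 ms0 => [|m IH] s ms le.
  by exists s; split=> //; apply: le_trans le _.
have [|big] := lerP (discrepancy s) (Posz (2 * 4 ^ (k ^ 2))); first by exists s.
have [s' [ms' lt]] := discrepancy_descent ms big.
by apply: IH ms' _; lia.
Qed.

End Switching.

(** * Counting edges through their ends *)

Lemma handshake (V : finType) (B : {set {set V}}) :
  (forall e, e \in B -> #|e| = 2) ->
  \sum_x #|[set y | (y != x) && ([set x; y] \in B)]| = 2 * #|B|.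
Proof.
move=> B2; transitivity (\sum_x \sum_(e in B) (x \in e : nat)).
  apply: eq_bigr => x _; rewrite -big_mkcondr.
  rewrite -(card_in_imset (f := fun y => [set x; y])) => [|y y']; last first.
    rewrite !inE => /andP[yx _] _ /setP/(_ y); rewrite !inE eqxx orbT (negPf yx) /=.
    by move/esym/eqP.
  rewrite -sum1_card; apply: eq_bigl => e.
  apply/imsetP/andP => [[y]|[eB xe]].
    by rewrite inE => /andP[_ yB] ->; rewrite set21.
  have /cards2P[a [b [ab eE]]] := introT eqP (B2 _ eB).
  move: xe; rewrite eE !inE => /orP[] /eqP->.
    by exists b; rewrite ?inE -?eE ?eB // eq_sym ab.
  by exists a; rewrite ?inE setUC -?eE ?eB ?ab.
rewrite exchange_big /= mulnC -sum_nat_const; apply: eq_bigr => e /B2 <-.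
by rewrite -sum1_card [RHS]big_mkcond.
Qed.

(** * From involutions back to perfect matchings of the complete graph *)

Section Matchings.
Variables (V : finType) (k : nat) (c : edge V -> 'I_k) (k0 : 0 < k).

(* On the diagonal, where [set x; x] is not an edge, this is a junk value. *)
Definition pair_colour (x y : V) : 'I_k :=
  odflt (Ordinal k0) (omap c (insub [set x; y])).

Lemma pair_colourC x y : pair_colour x y = pair_colour y x.
Proof. by rewrite /pair_colour setUC. Qed.

Lemma pair_colour_class x y i : y != x ->
  (pair_colour x y == i) = ([set x; y] \in val @: colour_class c i).
Proof.
move=> yx; rewrite /pair_colour.
case: insubP => [e _ ve|] /=; last by rewrite cards2 (eq_sym x) yx.
by rewrite -ve mem_imset ?inE //; exact: val_inj.
Qed.

Lemma card_edge : #|edge V| * 2 = #|V| * #|V|.-1.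
Proof.
by rewrite card_sig -cardsE card_draws (bin_ffact _ 2) ffactnS ffactn1.
Qed.

Lemma handshake_edges (A : {set edge V}) :
  \sum_x #|[set y | (y != x) && ([set x; y] \in val @: A)]| = 2 * #|A|.
Proof.
rewrite handshake ?card_imset //; first exact: val_inj.
by move=> _ /imsetP[e _ ->]; apply/eqP/(valP e).
Qed.

Lemma card_pair_colour n i : colour_balanced c -> #|V| = 2 * n * k ->
  \sum_x \sum_(y | y != x) (pair_colour x y == i : nat) = 2 * n * (#|V| - 1).
Proof.
move=> hc cV; transitivity (2 * #|colour_class c i|).
  rewrite -handshake_edges; apply: eq_bigr => x _.
  rewrite -sum1_card big_mkcond /= [RHS]big_mkcond /= big_mkcond /=.
  apply: eq_bigr => y _; rewrite !inE.
  by have [//|yx] := eqVneq y x; rewrite (pair_colour_class i yx).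
(* Multiplying by [k] turns the class size into the number of edges, twice which is N(N-1) with N =
   2nk. *)
apply/eqP; rewrite -(eqn_pmul2r k0) -mulnA hc mulnC card_edge cV.
by rewrite subn1; apply/eqP; ring.
Qed.

Definition matching_of (s : V -> V) : {set edge V} :=
  [set e | [exists x, val e == [set x; s x]]].

Lemma matching_ofP s e x : matching_map s -> e \in matching_of s -> x \in val e ->
  val e = [set x; s x].
Proof.
move=> [sK _]; rewrite inE => /existsP[z /eqP->]; rewrite !inE => /orP[] /eqP-> //.
by rewrite sK setUC.
Qed.

Lemma matching_of_perfect s : matching_map s -> perfect_matching (matching_of s).
Proof.
move=> ms; split=> [e1 e2 m1 m2|v].
  apply: contraR => /pred0Pn[z /andP[/= z1 z2]]; apply/eqP/val_inj.
  by rewrite (matching_ofP ms m1 z1) (matching_ofP ms m2 z2).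
have ve : #|[set v; s v]| == 2 by rewrite cards2 (eq_sym v); case: ms => _ ->.
exists (Sub [set v; s v] ve); last by rewrite SubK set21.
by rewrite inE; apply/existsP; exists v; rewrite SubK.
Qed.

(** In the matching, [x] has the single neighbour [s x], so its term in the handshake sum is 1 or 0
    according to the colour of that edge. *)
Lemma card_matching_of s i : matching_map s ->
  \sum_x (pair_colour x (s x) == i : nat) = 2 * #|colour_class c i :&: matching_of s|.
Proof.
move=> ms; have [sK sN] := ms.
rewrite -handshake_edges; apply: eq_bigr => x _.
rewrite (pair_colour_class i (sN x)).
have -> : [set y | (y != x) &&
      ([set x; y] \in val @: (colour_class c i :&: matching_of s))] =
    [set y in [set s x] | [set x; s x] \in val @: colour_class c i].
  apply/setP => y; rewrite !inE; apply/andP/andP => [[yx]|].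
    case/imsetP => e /setIP[ei em] ve.
    have e_s : val e = [set x; s x] by apply: matching_ofP em _; rewrite // -ve set21.
    split; last by rewrite -e_s imset_f.
    by move/setP/(_ y): ve; rewrite e_s !inE eqxx orbT (negPf yx) => /= /esym.
  case=> /eqP-> /imsetP[e ei ve]; split=> //.
  rewrite ve imset_f // inE ei inE; apply/existsP; exists x; exact/eqP.
case: (_ \in _).
  by rewrite -[LHS](cards1 (s x)); apply: eq_card => y; rewrite !inE andbT.
by apply/esym/eqP; rewrite cards_eq0; apply/eqP/setP => y; rewrite !inE andbF.
Qed.

Lemma discrepancy_imbalance n s : matching_map s ->
  discrepancy n pair_colour s = Posz (2 * imbalance n c (matching_of s)).
Proof.
move=> ms; rewrite /discrepancy /imbalance big_distrr /=.
rewrite Posz_sum; apply: eq_bigr => i _.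
rewrite /excess -Posz_sum.
by rewrite card_matching_of // !PoszM -mulrBr normrM abszE.
Qed.

End Matchings.

Theorem theorem1p3 (n k : nat) (hn : 0 < n) (hk : 0 < k)
  (c : edge 'I_(2 * n * k) -> 'I_k) (hc : colour_balanced c) :
  exists M : {set edge 'I_(2 * n * k)},
    perfect_matching M /\ imbalance n c M <= 4 ^ (k ^ 2).
Proof.
have cV : #|'I_(2 * n * k)| = 2 * n * k by exact: card_ord.
(* The starting matching pairs x with 2nk-1-x; these differ because their sum is odd. *)
have ms0 : matching_map (@rev_ord (2 * n * k)).
  split=> [|x]; first exact: rev_ordK.
  by apply/eqP => /(congr1 val) /=; have := ltn_ord x; lia.
have [s [ms le]] := low_discrepancy (pair_colourC c hk)
  (fun i => card_pair_colour hk i hc cV) hn hk cV ms0.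
exists (matching_of s); split; first exact: matching_of_perfect.
by move: le; rewrite discrepancy_imbalance // lez_nat leq_pmul2l.
Qed.
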